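(* For every Brouwer code $b:\mathrm B$, the map $\iota_b:[\![b]\!]_{\Sigma_1}\to[\![b]\!]_{\Sigma^1}$ (a map of underlying types) is (1) an embedding, (2) extremely dense, (3) order-preserving, (4) order-reflecting.
   Context: Foundation: intensional Martin-Löf type theory as in the HoTT Book, with $\mathbf 0$, $\mathbf 1$ (point $\star$), $\mathbf 2$ (points $0,1$), $\mathbb N$, $+$, $\Pi$, $\Sigma$, universes, univalence (hence function extensionality), propositional truncation and set quotients. No excluded middle is assumed. $f^{-1}(y):=\Sigma_x(f\,x=y)$; a map is an embedding if all its fibers are propositions (types with at most one element). A map $f:X\to Y$ is extremely dense if $\neg\,\Sigma_{y:Y}\,\neg\,\Sigma_{x:X}\,f\,x=y$. It is order-preserving if $x<x'\to f\,x<f\,x'$ and order-reflecting if $f\,x<f\,x'\to x<x'$. Ordinals. An ordinal is a type with a proposition-valued, transitive, extensional (elements with the same predecessors are equal), well-founded relation $<$; the same symbol denotes an ordinal and its underlying type. $\mathbf 1$ is an ordinal with the empty order. A topped ordinal is an ordinal with a specified point $t$ such that $\neg(t<y)$ for all $y$; $\mathrm{Ord}^\top$ is their type. For a topped ordinal $\tau$ and $\upsilon:\tau\to\mathrm{Ord}^\top$, $\Sigma_\tau\upsilon$ is the topped ordinal $\Sigma_{x:\tau}\upsilon\,x$ with the lexicographic order: $(x,a)<(x',a')$ iff $x<x'$, or there is $r:x=x'$ such that the transport of $a$ along $r$ is below $a'$; its top is the pair of tops. The sum $\tau+\upsilon$ of topped ordinals is the lexicographic sum, over the two-point topped ordinal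 with underlying type $\mathbf 1+\mathbf 1$ and $\mathrm{inl}\,\star<\mathrm{inr}\,\star$, of the family with members $\tau,\upsilon$; so its points are pairs $(\mathrm{inl}\,\star,x)$ with $x:\tau$ or $(\mathrm{inr}\,\star,y)$ with $y:\upsilon$. The topped ordinal $\omega+\mathbf 1$ is $\mathbb N+\mathbf 1$ with the usual order on $\mathbb N$ and the added point as top, above all $\mathrm{inl}\,n$. Conaturals: $\mathbb N_\infty:=\Sigma_{u:\mathbf 2^{\mathbb N}}\prod_i u_{i+1}\le u_i$; $\underline n$ is $n$ ones followed by zeros; $\infty$ is constantly $1$; $\iota:\mathbb N\hookrightarrow\mathbb N_\infty$, $\iota\,n=\underline n$. It is a topped ordinal with top $\infty$ under $u<v:\equiv\Sigma_{n:\mathbb N}(u=\underline n)\times(v_n=1)$. Let $\iota_1:\mathbb N+\mathbf 1\to\mathbb N_\infty$ send $\mathrm{inl}\,n$ to $\underline n$ and $\mathrm{inr}\,\star$ to $\infty$; it is left cancellable. Extension: for an embedding $j:X\hookrightarrow K$ and $\alpha:X\to\mathrm{Ord}^\top$, $(\alpha/j)\,k:=\prod_{(x,p):j^{-1}(k)}\alpha\,x$ with order $u<v:\equiv\Sigma_{p:j^{-1}(k)}\,u\,p<v\,p$ and top the function assigning tops. For $\upsilon:\mathbb N\to\mathrm{Ord}^\top$ put $\Sigma^1\upsilon:=\Sigma_{\mathbb N_\infty}(\upsilon/\iota)$ and $\Sigma_1\upsilon:=\Sigma_{\omega+\mathbf 1}(\upsilon/\mathrm{inl})$, where $\mathrm{inl}:\mathbb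 N\hookrightarrow\mathbb N+\mathbf 1$. Comparison map $\mathfrak c_\upsilon:\Sigma_1\upsilon\to\Sigma^1\upsilon$: $\mathfrak c_\upsilon(z,\psi)=(\iota_1\,z,e_z\,\psi)$ with $e_z\,\psi\,(n,q)=\psi(n,r_q)$, where for $q:\underline n=\iota_1\,z$, $r_q:\mathrm{inl}\,n=z$ is obtained by left-cancelling $\iota_1$ (as $\underline n=\iota_1(\mathrm{inl}\,n)$). Brouwer codes: $\mathrm B$ is the inductive type with constructors $\mathsf Z:\mathrm B$, $\mathsf S:\mathrm B\to\mathrm B$, $\mathsf L:(\mathbb N\to\mathrm B)\to\mathrm B$. Interpretations $[\![-]\!]_{\Sigma_1},[\![-]\!]_{\Sigma^1}:\mathrm B\to\mathrm{Ord}^\top$: both send $\mathsf Z$ to $\mathbf 1$ and $\mathsf S\,b$ to (interpretation of $b$)$\,+\mathbf 1$, while $[\![\mathsf L\,b]\!]_{\Sigma_1}=\Sigma_1(n\mapsto[\![b\,n]\!]_{\Sigma_1})$ and $[\![\mathsf L\,b]\!]_{\Sigma^1}=\Sigma^1(n\mapsto[\![b\,n]\!]_{\Sigma^1})$. The map $\iota_b:[\![b]\!]_{\Sigma_1}\to[\![b]\!]_{\Sigma^1}$ is defined by induction on $b$: $\iota_{\mathsf Z}=\mathrm{id}$; $\iota_{\mathsf S\,b}(\mathrm{inl}\,\star,y)=(\mathrm{inl}\,\star,\iota_b\,y)$ and $\iota_{\mathsf S\,b}(\mathrm{inr}\,\star,y)=(\mathrm{inr}\,\star,y)$; $\iota_{\mathsf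 L\,b}=\mathfrak c_\upsilon\circ F$, where $\upsilon\,i=[\![b\,i]\!]_{\Sigma^1}$ and $F:\Sigma_1(i\mapsto[\![b\,i]\!]_{\Sigma_1})\to\Sigma_1\upsilon$ applies $\iota_{b\,i}$ in the $i$-th summand and fixes the added point, i.e. $F(z,\psi)=(z,(n,r)\mapsto\iota_{b\,n}(\psi(n,r)))$. *)

(* Defs.v *)
From Stdlib Require Import Bool Arith Lia Peano_dec Eqdep_dec.
From Stdlib Require Export FunctionalExtensionality.

(* Homotopy type theory is rendered with [sigT] for sigma types, [eq] for
   identity types and maps into [False] for negation.  Relations take values
   in [Type]; being a proposition is the property [is_prop], which does not
   refer to the sort [Prop].  Of univalence, only its consequence function
   extensionality is assumed.  Neither UIP nor excluded middle is used. *)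

Definition neg (A : Type) : Prop := A -> False.

Definition is_prop (A : Type) : Prop := forall x y : A, x = y.

Definition is_set (A : Type) : Prop := forall x y : A, is_prop (x = y).

Definition fiber {X Y : Type} (f : X -> Y) (y : Y) : Type :=
  {x : X & f x = y}.

Definition is_embedding {X Y : Type} (f : X -> Y) : Prop :=
  forall y : Y, is_prop (fiber f y).

Definition left_cancellable {X Y : Type} (f : X -> Y) : Prop :=
  forall x x' : X, f x = f x' -> x = x'.

Definition extremely_dense {X Y : Type} (f : X -> Y) : Prop :=
  neg {y : Y & neg {x : X & f x = y}}.

Lemma is_set_of_constant_endomaps {A : Type}
  (f : forall x y : A, x = y -> x = y)
  (f_const : forall (x y : A) (p q : x = y), f x y p = f x y q) : is_set A.
Proof.
  assert (H : forall (x y : A) (p : x = y),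
             p = eq_trans (eq_sym (f x x eq_refl)) (f x y p)).
  { intros x y p; destruct p; symmetry; apply eq_trans_sym_inv_l. }
  intros x y p q; rewrite (H x y p), (H x y q), (f_const x y p q).
  reflexivity.
Qed.

Lemma is_prop_is_set {A : Type} : is_prop A -> is_set A.
Proof.
  intros H; apply (is_set_of_constant_endomaps (fun x y _ => H x y)).
  reflexivity.
Qed.

Lemma is_prop_forall {A : Type} {P : A -> Type} :
  (forall a, is_prop (P a)) -> is_prop (forall a, P a).
Proof. intros H f g; extensionality a; apply H. Qed.

Lemma is_prop_prod {A B : Type} : is_prop A -> is_prop B -> is_prop (A * B).
Proof.
  intros HA HB [a b] [a' b']; rewrite (HA a a'), (HB b b'); reflexivity.
Qed.

Lemma sigT_eq {A : Type} {P : A -> Type} (HP : forall a, is_prop (P a))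
  (u v : sigT P) : projT1 u = projT1 v -> u = v.
Proof.
  destruct u as [a p], v as [b q]; simpl; intros e; destruct e.
  rewrite (HP a p q); reflexivity.
Qed.

Lemma is_prop_sigT {A : Type} {P : A -> Type} :
  is_prop A -> (forall a, is_prop (P a)) -> is_prop (sigT P).
Proof. intros HA HP u v; apply (sigT_eq HP), HA. Qed.

Lemma left_cancellable_embedding {X Y : Type} (f : X -> Y) :
  is_set Y -> left_cancellable f -> is_embedding f.
Proof.
  intros HY Hf y [x p] [x' p']; apply sigT_eq; simpl.
  - intros a; apply HY.
  - apply Hf; rewrite p, p'; reflexivity.
Qed.

Lemma is_set_bool : is_set bool.
Proof. intros x y p q; apply UIP_dec, bool_dec. Qed.

Inductive accessible {X : Type} (R : X -> X -> Type) (x : X) : Type :=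
| accessible_intro : (forall y, R y x -> accessible R y) -> accessible R x.

Record Ord : Type := mkOrd {
  carrier :> Type;
  olt : carrier -> carrier -> Type;
  olt_prop : forall x y, is_prop (olt x y);
  olt_trans : forall x y z, olt x y -> olt y z -> olt x z;
  olt_ext : forall x y,
      (forall z, (olt z x -> olt z y) * (olt z y -> olt z x)) -> x = y;
  olt_wf : forall x, accessible olt x }.

Arguments olt {_} _ _.

Notation "x ≺ y" := (olt x y) (at level 70, no associativity).

Record TOrd : Type := mkTOrd {
  tord_ord :> Ord;
  top : tord_ord;
  top_max : forall y : tord_ord, neg (top ≺ y) }.

Arguments top {_}.

Definition order_preserving {A B : Ord} (f : A -> B) : Type :=
  forall x x' : A, x ≺ x' -> f x ≺ f x'.

Definition order_reflecting {A B : Ord} (f : A -> B) : Type :=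
  forall x x' : A, f x ≺ f x' -> x ≺ x'.

Lemma olt_irrefl (A : Ord) (x : A) : neg (x ≺ x).
Proof.
  induction (olt_wf A x) as [x _ IH]; intros l; exact (IH x l l).
Qed.

Lemma ord_is_set (A : Ord) : is_set A.
Proof.
  apply (is_set_of_constant_endomaps
    (fun x y (p : x = y) => olt_ext A x y
       (fun z => (fun l => eq_rect x (fun w => z ≺ w) l y p,
                  fun l => eq_rect_r (fun w => z ≺ w) l p)))).
  intros x y p q; f_equal; apply is_prop_forall; intros z.
  apply is_prop_prod; apply is_prop_forall; intros _; apply olt_prop.
Qed.

Definition one_lt (x y : unit) : Type := False.

Lemma one_lt_prop x y : is_prop (one_lt x y).
Proof.
  intros [].
Qed.

Lemma one_lt_trans x y z : one_lt x y -> one_lt y z -> one_lt x z.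
Proof.
  intros [].
Qed.

Lemma one_lt_ext x y :
  (forall z, (one_lt z x -> one_lt z y) * (one_lt z y -> one_lt z x)) -> x = y.
Proof.
  intros _; destruct x, y; reflexivity.
Qed.

Lemma one_lt_wf x : accessible one_lt x.
Proof.
  constructor; intros y l; destruct l.
Qed.

Lemma one_top_max x : neg (one_lt tt x).
Proof.
  intros l; exact l.
Qed.

Definition one_ord : TOrd :=
  mkTOrd (mkOrd unit one_lt one_lt_prop one_lt_trans one_lt_ext
            one_lt_wf)
    tt one_top_max.

Section LexicographicSum.

Context (T : TOrd) (U : T -> TOrd).

Definition sum_lt (s s' : {x : T & U x}) : Type :=
  (projT1 s ≺ projT1 s')
  + {r : projT1 s = projT1 s' &
      eq_rect (projT1 s) (fun x => carrier (U x)) (projT2 s) (projT1 s') r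
        ≺ projT2 s'}.

Lemma sum_lt_prop s s' : is_prop (sum_lt s s').
Proof.
  destruct s as [x a], s' as [x' a']; intros [l | [r l]] [l' | [r' l']];
    simpl in *.
  - f_equal; apply olt_prop.
  - destruct r'; destruct (olt_irrefl _ _ l).
  - destruct r; destruct (olt_irrefl _ _ l').
  - f_equal; apply sigT_eq; simpl.
    + intros e; apply olt_prop.
    + apply ord_is_set.
Qed.

Lemma sum_lt_trans s t u : sum_lt s t -> sum_lt t u -> sum_lt s u.
Proof.
  destruct s as [x a], t as [y b], u as [z c].
  intros [l | [r l]] [l' | [r' l']]; simpl in *.
  - left; exact (olt_trans _ _ _ _ l l').
  - destruct r'; left; exact l.
  - destruct r; left; exact l'.
  - destruct r, r'; right; exists eq_refl; exact (olt_trans _ _ _ _ l l').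
Qed.

Lemma sum_lt_ext s t :
  (forall u, (sum_lt u s -> sum_lt u t) * (sum_lt u t -> sum_lt u s)) -> s = t.
Proof.
  destruct s as [x a], t as [y b]; intros H.
  assert (e : x = y).
  { apply olt_ext; intros z; split; intros l.
    - destruct (fst (H (existT _ z top)) (inl l)) as [l' | [r l']];
        simpl in *; [exact l' | destruct r; destruct (top_max _ _ l')].
    - destruct (snd (H (existT _ z top)) (inl l)) as [l' | [r l']];
        simpl in *; [exact l' | destruct r; destruct (top_max _ _ l')]. }
  destruct e; f_equal.
  apply olt_ext; intros c; split; intros l.
  - destruct (fst (H (existT _ x c)) (inr (existT _ eq_refl l)))
      as [l' | [r l']]; simpl in *.
    + destruct (olt_irrefl _ _ l').
    + rewrite (ord_is_set _ _ _ r eq_refl) in l'; exact l'.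
  - destruct (snd (H (existT _ x c)) (inr (existT _ eq_refl l)))
      as [l' | [r l']]; simpl in *.
    + destruct (olt_irrefl _ _ l').
    + rewrite (ord_is_set _ _ _ r eq_refl) in l'; exact l'.
Qed.

Lemma sum_lt_wf s : accessible sum_lt s.
Proof.
  destruct s as [x a].
  induction (olt_wf T x) as [x _ IHx].
  induction (olt_wf (U x) a) as [a _ IHa].
  constructor; intros [y b] [l | [r l]]; simpl in *.
  - exact (IHx y l b).
  - destruct r; exact (IHa b l).
Qed.

Lemma sum_top_max s :
  neg (sum_lt (existT (fun x : T => carrier (U x)) top top) s).
Proof.
  destruct s as [x a]; intros [l | [r l]]; simpl in *.
  - exact (top_max _ _ l).
  - destruct r; exact (top_max _ _ l).
Qed.

Definition lex_sum : TOrd :=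
  mkTOrd (mkOrd {x : T & U x} sum_lt sum_lt_prop sum_lt_trans sum_lt_ext
            sum_lt_wf)
    (existT (fun x : T => carrier (U x)) top top) sum_top_max.

End LexicographicSum.

Definition two_lt (x y : unit + unit) : Type :=
  match x, y with inl _, inr _ => True | _, _ => False end.

Lemma two_lt_prop x y : is_prop (two_lt x y).
Proof.
  destruct x, y; intros [] []; reflexivity.
Qed.

Lemma two_lt_trans x y z : two_lt x y -> two_lt y z -> two_lt x z.
Proof.
  destruct x, y, z; intros [] []; exact I.
Qed.

Lemma two_lt_ext x y :
  (forall z, (two_lt z x -> two_lt z y) * (two_lt z y -> two_lt z x)) -> x = y.
Proof.
  destruct x as [[]|[]], y as [[]|[]]; intros H; try reflexivity.
  - destruct (snd (H (inl tt)) I).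
  - destruct (fst (H (inl tt)) I).
Qed.

Lemma two_lt_wf x : accessible two_lt x.
Proof.
  assert (H : forall u, accessible two_lt (inl u)).
  { intros u; constructor; intros [v|v] l; destruct l. }
  destruct x as [u|u]; [apply H|].
  constructor; intros [v|v] l; [apply H | destruct l].
Qed.

Lemma two_top_max x : neg (two_lt (inr tt) x).
Proof.
  intros l; exact l.
Qed.

Definition two_ord : TOrd :=
  mkTOrd (mkOrd (unit + unit) two_lt two_lt_prop two_lt_trans two_lt_ext
            two_lt_wf)
    (inr tt) two_top_max.

Definition add_ord (T U : TOrd) : TOrd :=
  lex_sum two_ord (fun x : unit + unit =>
                     match x with inl _ => T | inr _ => U end).

Definition omega1_lt (x y : nat + unit) : Type :=
  match x, y with
  | inl m, inl n => m < n
  | inl _, inr _ => True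
  | inr _, _ => False
  end.

Lemma omega1_lt_prop x y : is_prop (omega1_lt x y).
Proof.
  destruct x as [m|u], y as [n|v]; intros l l'; simpl in *; try contradiction.
  - apply le_unique.
  - destruct l, l'; reflexivity.
Qed.

Lemma omega1_lt_trans x y z : omega1_lt x y -> omega1_lt y z -> omega1_lt x z.
Proof.
  destruct x as [m|u], y as [n|v], z as [p|w]; simpl; try contradiction;
    try (intros; exact I).
  lia.
Qed.

Lemma omega1_lt_ext x y :
  (forall z, (omega1_lt z x -> omega1_lt z y) * (omega1_lt z y -> omega1_lt z x)) -> x = y.
Proof.
  destruct x as [m|[]], y as [n|[]]; intros H; try reflexivity.
  - f_equal; destruct (lt_eq_lt_dec m n) as [[l | e] | l]; [| exact e |].
    + pose proof (snd (H (inl m)) l) as l'; simpl in l'; lia.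
    + pose proof (fst (H (inl n)) l) as l'; simpl in l'; lia.
  - pose proof (snd (H (inl m)) I) as l'; simpl in l'; lia.
  - pose proof (fst (H (inl n)) I) as l'; simpl in l'; lia.
Qed.

Lemma omega1_lt_wf x : accessible omega1_lt x.
Proof.
  assert (H : forall n m, m < n -> accessible omega1_lt (inl m)).
  { induction n as [|n IH]; intros m l; [lia|].
    constructor; intros [p|u] l'; simpl in l'; [apply IH; lia | contradiction]. }
  destruct x as [n|u]; [apply (H (S n)); lia|].
  constructor; intros [m|v] l; [apply (H (S m)); lia | destruct l].
Qed.

Lemma omega1_top_max x : neg (omega1_lt (inr tt) x).
Proof.
  intros l; exact l.
Qed.

Definition omega1 : TOrd :=
  mkTOrd (mkOrd (nat + unit) omega1_lt omega1_lt_prop omega1_lt_trans omega1_lt_ext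
            omega1_lt_wf)
    (inr tt) omega1_top_max.

Definition conat : Type :=
  {u : nat -> bool & forall i, Bool.le (u (S i)) (u i)}.

Definition conat_fun (u : conat) : nat -> bool := projT1 u.
Coercion conat_fun : conat >-> Funclass.

Lemma ltb_decreasing (n i : nat) :
  Bool.le (Nat.ltb (S i) n) (Nat.ltb i n).
Proof.
  destruct (Nat.ltb_spec (S i) n), (Nat.ltb_spec i n); simpl; trivial.
  lia.
Qed.

Definition underline (n : nat) : conat :=
  existT _ (fun i => Nat.ltb i n) (ltb_decreasing n).

Definition infty : conat := existT _ (fun _ => true) (fun _ => eq_refl).

Lemma conat_eq (u v : conat) : (forall i, u i = v i) -> u = v.
Proof.
  intros H; apply sigT_eq.
  - intros f; apply is_prop_forall; intros i p q.
    destruct (f (S i)); simpl in *; [apply is_set_bool | now destruct p, q].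
  - extensionality i; apply H.
Qed.

Lemma conat_is_set : is_set conat.
Proof.
  apply (is_set_of_constant_endomaps
    (fun u v (p : u = v) =>
       conat_eq u v (fun i => f_equal (fun w : conat => w i) p))).
  intros u v p q; f_equal; apply is_prop_forall; intros i; apply is_set_bool.
Qed.

Lemma conat_down (u : conat) (m n : nat) : m <= n -> u n = true -> u m = true.
Proof.
  intros l; induction l as [|n l IH]; [trivial|].
  intros e; apply IH; pose proof (projT2 u n) as h; simpl in h.
  change (Bool.le (u (S n)) (u n)) in h; rewrite e in h; exact h.
Qed.

Lemma underline_true (n i : nat) : underline n i = true -> i < n.
Proof. exact (proj1 (Nat.ltb_lt i n)). Qed.

Lemma underline_lc : left_cancellable underline.
Proof.
  intros m n e; destruct (lt_eq_lt_dec m n) as [[l | h] | l]; [| exact h |].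
  - apply (proj2 (Nat.ltb_lt m n)) in l.
    change (underline n m = true) in l; rewrite <- e in l.
    apply underline_true in l; lia.
  - apply (proj2 (Nat.ltb_lt n m)) in l.
    change (underline m n = true) in l; rewrite e in l.
    apply underline_true in l; lia.
Qed.

Lemma infty_not_underline (n : nat) : underline n <> infty.
Proof.
  intros e; assert (h : underline n n = true) by (rewrite e; reflexivity).
  apply underline_true in h; lia.
Qed.

Lemma underline_embedding : is_embedding underline.
Proof. exact (left_cancellable_embedding _ conat_is_set underline_lc). Qed.

Definition conat_lt (u v : conat) : Type :=
  {n : nat & ((u = underline n) * (v n = true))%type}.

Lemma conat_lt_prop x y : is_prop (conat_lt x y).
Proof.
  intros [m [p q]] [n [p' q']]; apply sigT_eq; simpl.
  - intros k; apply is_prop_prod; [apply conat_is_set | apply is_set_bool].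
  - apply underline_lc; rewrite <- p, <- p'; reflexivity.
Qed.

Lemma conat_lt_trans x y z : conat_lt x y -> conat_lt y z -> conat_lt x z.
Proof.
  intros [m [p q]] [n [p' q']]; exists m; split; [exact p|].
  rewrite p' in q; apply underline_true in q.
  apply (conat_down z m n); [lia | exact q'].
Qed.

Lemma conat_lt_ext x y :
  (forall z, (conat_lt z x -> conat_lt z y) * (conat_lt z y -> conat_lt z x)) -> x = y.
Proof.
  intros H; apply conat_eq; intros i.
  assert (h : x i = true -> y i = true).
  { intros e; destruct (fst (H (underline i)) (existT _ i (eq_refl, e)))
      as [j [p q]]; apply underline_lc in p; rewrite p; exact q. }
  assert (h' : y i = true -> x i = true).
  { intros e; destruct (snd (H (underline i)) (existT _ i (eq_refl, e)))
      as [j [p q]]; apply underline_lc in p; rewrite p; exact q. }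
  destruct (x i), (y i); auto; symmetry; auto.
Qed.

Lemma conat_lt_wf x : accessible conat_lt x.
Proof.
  assert (H : forall n m, m < n -> accessible conat_lt (underline m)).
  { induction n as [|n IH]; intros m l; [lia|].
    constructor; intros u [k [p q]]; rewrite p; apply IH.
    apply underline_true in q; lia. }
  constructor; intros v [k [p q]]; rewrite p.
  apply (H (S k)); lia.
Qed.

Lemma conat_top_max x : neg (conat_lt infty x).
Proof.
  intros [n [p _]]; exact (infty_not_underline n (eq_sym p)).
Qed.

Definition conat_ord : TOrd :=
  mkTOrd (mkOrd conat conat_lt conat_lt_prop conat_lt_trans conat_lt_ext
            conat_lt_wf)
    infty conat_top_max.

Definition iota1 (z : nat + unit) : conat :=
  match z with inl n => underline n | inr _ => infty end.

Lemma iota1_lc : left_cancellable iota1.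
Proof.
  intros [m|[]] [n|[]] e; simpl in e.
  - f_equal; exact (underline_lc m n e).
  - destruct (infty_not_underline m e).
  - destruct (infty_not_underline n (eq_sym e)).
  - reflexivity.
Qed.

Lemma inl_embedding : is_embedding (@inl nat unit).
Proof.
  apply left_cancellable_embedding.
  - exact (ord_is_set omega1).
  - intros m n e; injection e; trivial.
Qed.

Section Extension.

Context {X K : Type} (j : X -> K) (j_emb : is_embedding j) (A : X -> TOrd).

Definition extension_lt (k : K) (u v : forall p : fiber j k, A (projT1 p)) :
    Type :=
  {p : fiber j k & u p ≺ v p}.

Lemma extension_lt_prop k u v : is_prop (extension_lt k u v).
Proof.
  apply is_prop_sigT; [apply j_emb | intros p; apply olt_prop].
Qed.

Lemma extension_lt_trans k u v w :
  extension_lt k u v -> extension_lt k v w -> extension_lt k u w.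
Proof.
  intros [p l] [q l']; destruct (j_emb k p q); exists p.
  exact (olt_trans _ _ _ _ l l').
Qed.

Lemma extension_lt_ext k u v :
  (forall w, (extension_lt k w u -> extension_lt k w v)
             * (extension_lt k w v -> extension_lt k w u)) -> u = v.
Proof.
  intros H; extensionality p.
  set (w := fun (a : A (projT1 p)) q =>
              eq_rect p (fun q => carrier (A (projT1 q))) a q (j_emb k p q)).
  assert (wp : forall a, w a p = a).
  { intros a; unfold w.
    rewrite (is_prop_is_set (j_emb k) p p (j_emb k p p) eq_refl); reflexivity. }
  assert (lw : forall a v', extension_lt k (w a) v' -> a ≺ v' p).
  { intros a v' [q l]; revert l; destruct (j_emb k p q).
    rewrite wp; trivial. }
  assert (wl : forall a v', a ≺ v' p -> extension_lt k (w a) v').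
  { intros a v' l; exists p; rewrite wp; exact l. }
  apply olt_ext; intros a; split; intros l; apply lw; apply (H (w a)), wl, l.
Qed.

Lemma extension_lt_wf k u : accessible (extension_lt k) u.
Proof.
  assert (H : forall p (a : A (projT1 p)) u,
             u p = a -> accessible (extension_lt k) u).
  { intros p a; induction (olt_wf _ a) as [a _ IH]; intros v e.
    constructor; intros w [q l]; destruct (j_emb k p q).
    rewrite e in l; exact (IH (w p) l w eq_refl). }
  constructor; intros v [p _]; exact (H p (v p) v eq_refl).
Qed.

Lemma extension_top_max k u : neg (extension_lt k (fun p => top) u).
Proof. intros [p l]; exact (top_max _ _ l). Qed.

Definition extension (k : K) : TOrd :=
  mkTOrd (mkOrd (forall p : fiber j k, A (projT1 p)) (extension_lt k)
            (extension_lt_prop k) (extension_lt_trans k)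
            (extension_lt_ext k) (extension_lt_wf k))
    (fun p => top) (extension_top_max k).

End Extension.

Definition sum_sup1 (U : nat -> TOrd) : TOrd :=
  lex_sum conat_ord (extension underline underline_embedding U).

Definition sum_sub1 (U : nat -> TOrd) : TOrd :=
  lex_sum omega1 (extension (@inl nat unit) inl_embedding U).

Definition cancel_iota1 {z : nat + unit} {n : nat}
    (q : underline n = iota1 z) : inl n = z :=
  iota1_lc (inl n) z q.

Definition comparison_fiber (U : nat -> TOrd) (z : nat + unit)
    (psi : extension (@inl nat unit) inl_embedding U z) :
    extension underline underline_embedding U (iota1 z) :=
  fun p => psi (existT _ (projT1 p) (cancel_iota1 (projT2 p))).

Definition comparison (U : nat -> TOrd) (s : sum_sub1 U) : sum_sup1 U :=
  existT _ (iota1 (projT1 s)) (comparison_fiber U (projT1 s) (projT2 s)).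

Inductive brouwer : Type :=
| BZ : brouwer
| BS : brouwer -> brouwer
| BL : (nat -> brouwer) -> brouwer.

Fixpoint interp_sub1 (b : brouwer) : TOrd :=
  match b with
  | BZ => one_ord
  | BS b => add_ord (interp_sub1 b) one_ord
  | BL b => sum_sub1 (fun n => interp_sub1 (b n))
  end.

Fixpoint interp_sup1 (b : brouwer) : TOrd :=
  match b with
  | BZ => one_ord
  | BS b => add_ord (interp_sup1 b) one_ord
  | BL b => sum_sup1 (fun n => interp_sup1 (b n))
  end.

Definition succ_map {T U : TOrd} (f : T -> U) (s : add_ord T one_ord) :
    add_ord U one_ord :=
  match s with
  | existT _ (inl u) y => existT _ (inl u) (f y)
  | existT _ (inr u) y => existT _ (inr u) y
  end.

Definition sum_sub1_map {T U : nat -> TOrd} (f : forall n, T n -> U n)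
    (s : sum_sub1 T) : sum_sub1 U :=
  existT _ (projT1 s)
    (fun p : fiber inl (projT1 s) => f (projT1 p) (projT2 s p)).

Fixpoint iota_map (b : brouwer) : interp_sub1 b -> interp_sup1 b :=
  match b return interp_sub1 b -> interp_sup1 b with
  | BZ => fun x => x
  | BS b => succ_map (iota_map b)
  | BL b => fun s =>
      comparison (fun n => interp_sup1 (b n))
        (sum_sub1_map (fun n => iota_map (b n)) s)
  end.

(* Main.v *)
From Stdlib Require Import Arith Lia.
Require Import Defs.

(** Every step of the construction of [iota_map] is a map of lexicographic sums
    over a map of index ordinals, and all four properties pass from the index
    map and the maps of summands to the map of sums.  For [BS] the index map is
    the identity of the two-point ordinal.  For [BL] it is [iota1], from
    [omega1] to the conaturals, and the map of summands over [z] is a map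
    between products indexed by the fibers of [inl] over [z] and of
    [underline] over [iota1 z].  Because [iota1] is left cancellable and
    restricts to [underline] along [inl], those two fibers are equivalent
    propositions, so such a map of products inherits what is known of the maps
    given by the induction hypothesis.

    Density is the point where constructivity matters.  A conatural that differs
    from every [underline n] is [infty], so [iota1] misses no point, although it
    cannot be shown surjective ([iota1_dense]).  In a lexicographic sum, a point
    [(y, b)] outside the image must have its index [y] outside the image of the
    index map: if [y] is [f x], then [b] is missed by the map of summands over
    [x], contradicting its density ([lex_map_dense]).  For the products, it
    matters that the index [z] lies in [nat + unit], where it is decidable
    whether the fiber of [inl] is inhabited: the product over it is a single
    factor or a point ([limit_fiber_map_dense]).

    A left cancellable map into a set is an embedding, and ordinals are sets, so
    left cancellability is all that is proved by induction for the first
    property. *)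

(** * Maps of lexicographic sums *)

Section LexMap.

Context {T T' : TOrd} {U : T -> TOrd} {U' : T' -> TOrd}.
Context (f : T -> T') (g : forall x, U x -> U' (f x)).

Definition lex_map (s : lex_sum T U) : lex_sum T' U' :=
  existT (fun y => carrier (U' y)) (f (projT1 s)) (g (projT1 s) (projT2 s)).

Lemma lex_map_left_cancellable :
  left_cancellable f -> (forall x, left_cancellable (g x)) ->
  left_cancellable lex_map.
Proof.
  intros Hf Hg [x a] [x' a'] e.
  pose proof (projT2_eq e) as h; simpl in h.
  set (r := projT1_eq e) in h; clearbody r; simpl in r.
  pose proof (Hf x x' r) as q; destruct q.
  rewrite (ord_is_set T' _ _ r eq_refl) in h; simpl in h.
  rewrite (Hg x a a' h); reflexivity.
Qed.

(** An existence statement is not available for the index [y], only the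
    impossibility of its absence; so [y] is shown to have no preimage, and the
    density of [f] refutes this. *)
Lemma lex_map_dense :
  extremely_dense f -> (forall x, extremely_dense (g x)) ->
  extremely_dense lex_map.
Proof.
  intros Hf Hg [[y b] H].
  apply Hf; exists y; intros [x e]; destruct e.
  apply (Hg x); exists b; intros [a e]; destruct e.
  apply H; exists (existT _ x a); reflexivity.
Qed.

Lemma lex_map_preserving :
  order_preserving f -> (forall x, order_preserving (g x)) ->
  order_preserving lex_map.
Proof.
  intros Hf Hg [x a] [x' a'] [l | [r l]]; simpl in *.
  - left; exact (Hf x x' l).
  - destruct r; right; exists eq_refl; exact (Hg x a a' l).
Qed.

(** Left cancellability of [f] is what makes an inequality inside one summand of
    the codomain come from a single summand of the domain. *)
Lemma lex_map_reflecting :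
  left_cancellable f -> order_reflecting f ->
  (forall x, order_reflecting (g x)) -> order_reflecting lex_map.
Proof.
  intros Hc Hf Hg [x a] [x' a'] [l | [r l]]; simpl in *.
  - left; exact (Hf x x' l).
  - pose proof (Hc x x' r) as q; destruct q.
    rewrite (ord_is_set T' _ _ r eq_refl) in l.
    right; exists eq_refl; exact (Hg x a a' l).
Qed.

End LexMap.

Lemma id_dense (A : Type) : extremely_dense (fun x : A => x).
Proof. intros [y H]; apply H; exists y; reflexivity. Qed.

(** * Successors *)

Section Successor.

Context {T U : TOrd} (f : T -> U).

Definition summand (V : TOrd) (x : two_ord) : TOrd :=
  match x with inl _ => V | inr _ => one_ord end.

Definition summand_map (x : two_ord) : summand T x -> summand U x :=
  match x with inl _ => f | inr _ => fun y => y end.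

Lemma succ_map_lex :
  succ_map f
  = lex_map (T := two_ord) (T' := two_ord) (U := summand T) (U' := summand U)
      (fun x => x) summand_map.
Proof. extensionality s; destruct s as [[u | u] y]; reflexivity. Qed.

Lemma succ_map_left_cancellable :
  left_cancellable f -> left_cancellable (succ_map f).
Proof.
  intros Hf; rewrite succ_map_lex; apply lex_map_left_cancellable.
  - intros x x' e; exact e.
  - intros [u | u]; [exact Hf | intros y y' e; exact e].
Qed.

Lemma succ_map_dense : extremely_dense f -> extremely_dense (succ_map f).
Proof.
  intros Hf; rewrite succ_map_lex; apply lex_map_dense.
  - apply id_dense.
  - intros [u | u]; [exact Hf | apply id_dense].
Qed.

Lemma succ_map_preserving : order_preserving f -> order_preserving (succ_map f).
Proof.
  intros Hf; rewrite succ_map_lex; apply lex_map_preserving.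
  - intros x x' l; exact l.
  - intros [u | u]; [exact Hf | intros y y' l; exact l].
Qed.

Lemma succ_map_reflecting : order_reflecting f -> order_reflecting (succ_map f).
Proof.
  intros Hf; rewrite succ_map_lex; apply lex_map_reflecting.
  - intros x x' e; exact e.
  - intros x x' l; exact l.
  - intros [u | u]; [exact Hf | intros y y' l; exact l].
Qed.

End Successor.

(** * The inclusion of ω + 1 in the conaturals *)

(** If [u] begins with [i] ones, then its next value is a one as well: a zero
    there would force zeros from then on, so [u] would be [underline i]. *)
Lemma not_underline_infty (u : conat) :
  (forall n, u <> underline n) -> u = infty.
Proof.
  intros H; apply conat_eq.
  assert (below : forall i k, k < i -> u k = true).
  { induction i as [|i IH]; intros k l; [lia|].
    destruct (Nat.eq_dec k i) as [e | ne]; [subst k | apply IH; lia].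
    destruct (u i) eqn:ui; [reflexivity | exfalso].
    apply (H i), conat_eq; intros m.
    change (u m = Nat.ltb m i).
    destruct (Nat.ltb_spec m i) as [lm | lm]; [exact (IH m lm)|].
    destruct (u m) eqn:um; [| reflexivity].
    rewrite (conat_down u i m lm um) in ui; discriminate ui. }
  intros i; exact (below (S i) i (Nat.lt_succ_diag_r i)).
Qed.

Lemma iota1_dense : extremely_dense iota1.
Proof.
  intros [u H]; apply H; exists (inr tt); symmetry.
  apply not_underline_infty; intros n e.
  apply H; exists (inl n); symmetry; exact e.
Qed.

Lemma iota1_preserving :
  order_preserving (A := omega1) (B := conat_ord) iota1.
Proof.
  intros [m | v] [n | w] l; simpl in l; try contradiction.
  - exists m; split; [reflexivity | apply Nat.ltb_lt; exact l].
  - exists m; split; reflexivity.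
Qed.

Lemma iota1_reflecting :
  order_reflecting (A := omega1) (B := conat_ord) iota1.
Proof.
  intros [m | v] z' [k [p q]]; simpl in p.
  - apply underline_lc in p; destruct p.
    destruct z' as [n | w]; simpl in q |- *; [| exact I].
    exact (underline_true n m q).
  - destruct (infty_not_underline k (eq_sym p)).
Qed.

(** * Limits *)

Section Limit.

Context {T U : nat -> TOrd} (f : forall n, T n -> U n).

(** The maps of summands through which [comparison] after [sum_sub1_map] is, by
    computation, a map of lexicographic sums over [iota1]. *)
Definition limit_fiber_map (z : omega1)
    (psi : extension (@inl nat unit) inl_embedding T z) :
    extension underline underline_embedding U (iota1 z) :=
  fun p => f (projT1 p) (psi (existT _ (projT1 p) (cancel_iota1 (projT2 p)))).

(** Cancellation undoes the evident passage from the fiber of [inl] to the fiber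
    of [underline], because both equations live in a set. *)
Lemma cancel_iota1_f_equal {z : nat + unit} {n : nat} (r : inl n = z) :
  cancel_iota1 (f_equal iota1 r) = r.
Proof. apply (ord_is_set omega1). Qed.

Lemma limit_fiber_map_at (z : omega1) psi (p : fiber inl z) :
  limit_fiber_map z psi (existT _ (projT1 p) (f_equal iota1 (projT2 p)))
  = f (projT1 p) (psi p).
Proof.
  destruct p as [n r]; unfold limit_fiber_map; simpl.
  rewrite (cancel_iota1_f_equal r); reflexivity.
Qed.

Lemma limit_fiber_map_left_cancellable (z : omega1) :
  (forall n, left_cancellable (f n)) -> left_cancellable (limit_fiber_map z).
Proof.
  intros Hf psi psi' e; extensionality p; apply Hf.
  rewrite <- !limit_fiber_map_at, e; reflexivity.
Qed.

(** Over [inl n] the products have the single factors [T n] and [U n], so a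
    preimage under [f n] of the component of [phi] gives one of [phi].  Over the
    added point both products are empty. *)
Lemma limit_fiber_map_dense (z : omega1) :
  (forall n, extremely_dense (f n)) -> extremely_dense (limit_fiber_map z).
Proof.
  intros Hf [phi H]; destruct z as [n | v].
  - apply (Hf n); exists (phi (existT _ n eq_refl)); intros [a e].
    apply H.
    (* The point [a] spreads over the whole fiber, which is a proposition. *)
    exists (fun p : fiber inl (inl n) =>
              eq_rect (existT _ n eq_refl) (fun p => carrier (T (projT1 p)))
                a p (inl_embedding _ _ p)).
    extensionality p.
    destruct (underline_embedding _ (existT _ n eq_refl) p).
    unfold limit_fiber_map; simpl.
    refine (eq_trans (f_equal (f n) _) e).
    change (eq_refl (underline n)) with (f_equal iota1 (eq_refl (inl n))).
    rewrite cancel_iota1_f_equal.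
    rewrite (is_prop_is_set (inl_embedding (inl n)) _ _ _ eq_refl).
    reflexivity.
  - apply H; unshelve eexists.
    + intros [n r]; discriminate r.
    + extensionality p; destruct p as [n q].
      destruct (infty_not_underline n q).
Qed.

Lemma limit_fiber_map_preserving (z : omega1) :
  (forall n, order_preserving (f n)) -> order_preserving (limit_fiber_map z).
Proof.
  intros Hf psi psi' [p l].
  exists (existT _ (projT1 p) (f_equal iota1 (projT2 p))).
  rewrite !limit_fiber_map_at; exact (Hf _ _ _ l).
Qed.

Lemma limit_fiber_map_reflecting (z : omega1) :
  (forall n, order_reflecting (f n)) -> order_reflecting (limit_fiber_map z).
Proof.
  intros Hf psi psi' [p l].
  exists (existT _ (projT1 p) (cancel_iota1 (projT2 p))).
  exact (Hf _ _ _ l).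
Qed.

Definition limit_map (s : sum_sub1 T) : sum_sup1 U :=
  comparison U (sum_sub1_map f s).

Lemma limit_map_left_cancellable :
  (forall n, left_cancellable (f n)) -> left_cancellable limit_map.
Proof.
  intros Hf; apply (lex_map_left_cancellable (T := omega1) (T' := conat_ord)
                      iota1 limit_fiber_map iota1_lc).
  intros z; exact (limit_fiber_map_left_cancellable z Hf).
Qed.

Lemma limit_map_dense :
  (forall n, extremely_dense (f n)) -> extremely_dense limit_map.
Proof.
  intros Hf; apply (lex_map_dense (T := omega1) (T' := conat_ord)
                      iota1 limit_fiber_map iota1_dense).
  intros z; exact (limit_fiber_map_dense z Hf).
Qed.

Lemma limit_map_preserving :
  (forall n, order_preserving (f n)) -> order_preserving limit_map.
Proof.
  intros Hf; apply (lex_map_preserving (T := omega1) (T' := conat_ord)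
                      iota1 limit_fiber_map iota1_preserving).
  intros z; exact (limit_fiber_map_preserving z Hf).
Qed.

Lemma limit_map_reflecting :
  (forall n, order_reflecting (f n)) -> order_reflecting limit_map.
Proof.
  intros Hf; apply (lex_map_reflecting (T := omega1) (T' := conat_ord)
                      iota1 limit_fiber_map iota1_lc iota1_reflecting).
  intros z; exact (limit_fiber_map_reflecting z Hf).
Qed.

End Limit.

(** * Brouwer codes *)

Lemma iota_map_left_cancellable (b : brouwer) : left_cancellable (iota_map b).
Proof.
  induction b as [|b IH|b IH].
  - intros x y e; exact e.
  - exact (succ_map_left_cancellable _ IH).
  - exact (limit_map_left_cancellable _ IH).
Qed.

Theorem theorem6p23 (b : brouwer) :
  (is_embedding (iota_map b)
   * extremely_dense (iota_map b)
   * order_preserving (iota_map b)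
   * order_reflecting (iota_map b))%type.
Proof.
  repeat split.
  - exact (left_cancellable_embedding _ (ord_is_set (interp_sup1 b))
             (iota_map_left_cancellable b)).
  - induction b as [|b IH|b IH].
    + apply id_dense.
    + exact (succ_map_dense _ IH).
    + exact (limit_map_dense _ IH).
  - induction b as [|b IH|b IH].
    + intros x y l; exact l.
    + exact (succ_map_preserving _ IH).
    + exact (limit_map_preserving _ IH).
  - induction b as [|b IH|b IH].
    + intros x y l; exact l.
    + exact (succ_map_reflecting _ IH).
    + exact (limit_map_reflecting _ IH).
Qed.
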